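(* Let $\{X_f\}_{f\in\mathcal F}$ be a regular family of random variables, i.e. $\sup_{f\in\mathcal F}\mathbf E[X_f^2]<\infty$. Then the following statements are equivalent: 1. There is an ESI function $u$ such that for all $f\in\mathcal F$, $X_f\trianglelefteq_u 0$. 2. There are constants $C^*>0$ and $\eta^*>0$ such that, uniformly over all $f\in\mathcal F$, $X_f\le X_f-\mathbf E[X_f]$ and $X_f-\mathbf E[X_f]\trianglelefteq_{\eta^*}C^*$. 3. There exist $c,v>0$ such that, for all $f\in\mathcal F$, $X_f$ is subcentered and has a $(c,v)$-subgamma right tail. 4. There is an ESI function $h$ of the form $h(\epsilon)=\min\{C\epsilon,\eta^*\}$ such that, for all $f\in\mathcal F$, $X_f\le X_f-\mathbf E[X_f]$ and $X_f-\mathbf E[X_f]\trianglelefteq_h 0$. 5. There exist $c,v>0$ such that, for all $f\in\mathcal F$, $X_f$ is subcentered and, for each $f\in\mathcal F$ and $0<\delta\le1$, with probability at least $1-\delta$, $$X_f\le\sqrt{2v\log(1/\delta)}+c\log(1/\delta).$$ 6. There exist $a>0$ and a differentiable function $h:[0,\infty)\to[0,\infty)$ with $h(\epsilon)>0$ and $h'(\epsilon)\ge0$ for $\epsilon>0$, such that for all $f\in\mathcal F$, $X_f$ is subcentered and $P(X_f\ge\epsilon)\le a\exp(-h(\epsilon))$ (in particular $h$ may be a positive constant or a linear function of $\epsilon$).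
   Context: All random variables are real-valued on a common probability space $(\Omega,\Sigma,P)$, with well-defined expectations. For a constant $\eta>0$, $X\trianglelefteq_\eta Y$ means $\mathbf E[e^{\eta(X-Y)}]\le1$. An ESI function is a continuous, nondecreasing, strictly positive function $u:(0,\infty)\to(0,\infty)$; $X\trianglelefteq_uY$ means that for all $\epsilon>0$, $\mathbf E[e^{u(\epsilon)(X-Y)}]\le e^{u(\epsilon)\epsilon}$. A random variable $X$ is subcentered if $\mathbf E[X]\le0$. $X$ has a $(c,v)$-subgamma right tail ($c,v>0$) if for all $\eta>0$ with $c\eta<1$, $X-\mathbf E[X]\trianglelefteq_\eta\frac12\frac{v\eta}{1-c\eta}$.
   Formalization: In item 6 the tail bound is proved with a·exp(−ε·h(ε)) instead of a·exp(−h(ε)); as printed, a constant h with large a makes the bound vacuous, so item 6 would only say that each X_f is subcentered and the equivalence fails. *)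

(* Defs.v *)
From HB Require Import structures.
From mathcomp Require Export all_boot all_order all_algebra.
From mathcomp Require Export all_classical all_reals all_analysis.
Export Order.TTheory GRing.Theory Num.Theory.
Export numFieldNormedType.Exports.

Set Implicit Arguments.
Unset Strict Implicit.
Unset Printing Implicit Defensive.

Local Open Scope classical_set_scope.
Local Open Scope ring_scope.

Section ESI.
Context {d : measure_display} {T : measurableType d} {R : realType}.
Variable P : probability T R.

(* X \trianglelefteq_eta Y; the expectation is extended-real valued, so
   integrability of the exponential is part of the inequality *)
Definition esi (eta : R) (X Y : T -> R) : Prop :=
  ('E_P[(fun w => expR (eta * (X w - Y w)))%R] <= 1)%E.

(* X \trianglelefteq_u Y *)
Definition esi_fun (u : R -> R) (X Y : T -> R) : Prop :=
  forall eps : R, 0 < eps ->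
    ('E_P[(fun w => expR (u eps * (X w - Y w)))%R]
       <= (expR (u eps * eps))%:E)%E.

Definition subcentered (X : T -> R) : Prop := ('E_P[X] <= 0)%E.

(* [fine] sends infinite values to 0; this is X - E[X] only when E[X] is
   finite, which holds for square-integrable X *)
Definition centered (X : T -> R) : T -> R := fun w => X w - fine 'E_P[X].

Definition subgamma_right_tail (c v : R) (X : T -> R) : Prop :=
  forall eta : R, 0 < eta -> c * eta < 1 ->
    esi eta (centered X) (cst (2^-1 * (v * eta / (1 - c * eta)))).

Definition regular_family (F : Type) (X : F -> {RV P >-> R}) : Prop :=
  (ereal_sup [set 'E_P[(fun w => X f w ^+ 2)%R] | f in [set: F]] < +oo)%E.

End ESI.

(* A function (0,oo) -> (0,oo) is a total u : R -> R whose values outside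
   (0,oo) play no role. *)
Definition ESI_function {R : realType} (u : R -> R) : Prop :=
  [/\ {within `]0, +oo[%classic, continuous u},
      forall x y, 0 < x -> x <= y -> u x <= u y &
      forall eps, 0 < eps -> 0 < u eps].

(* Differentiability on [0,oo), one-sided at the endpoint. *)
Definition differentiable_nonneg {R : realType} (h : R -> R) : Prop :=
  (forall eps, 0 < eps -> derivable h eps 1) /\
  cvg ((fun t => (h t - h 0) / t) @ 0^'+).

Definition tail_rate {R : realType} (h : R -> R) : Prop :=
  [/\ differentiable_nonneg h,
      forall eps, 0 <= eps -> 0 <= h eps,
      forall eps, 0 < eps -> 0 < h eps &
      forall eps, 0 < eps -> 0 <= derive1 h eps].

(* Main.v *)
Require Import Defs.
From mathcomp Require Import measurable_realfun ring lra.

Set Implicit Arguments.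
Unset Strict Implicit.
Unset Printing Implicit Defensive.

Local Open Scope classical_set_scope.
Local Open Scope ring_scope.

(* All implications but two are Markov's and Jensen's inequalities. The key
   estimate is the second-order bound
     e^(t x) <= 1 + t x + t^2 (x^2 + 8 s^-2 e^(s x))   for 0 < t <= s / 2,
   which for a family with E[X] <= 0, bounded second moments and one uniformly
   bounded exponential moment E[e^(s X)] gives E[e^(t X)] <= e^(t^2 V), i.e.
   the ESI of X at rate t with slack t V. It is applied to X - E[X] to get the
   subgamma tail from (2), and to X itself to get an ESI function of the form
   min(eps / V, s / 2) from (6), where the tail rate is at least h 1 beyond 1. *)

(** * Pointwise second-order bounds on the exponential *)

Lemma expR_le_pos (R : realType) (x : R) : 0 <= x ->
  expR x <= 1 + x + x ^+ 2 * expR x.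
Proof.
move=> x0; have e0 := expR_gt0 x.
(* This is 1 - x <= e^(-x) multiplied by e^x. It reads e^x <= 1 + x e^x, and inserting it into its
   own right-hand side, with x >= 0, gives the claim. *)
have : (1 - x) * expR x <= 1.
  rewrite -[leRHS](@expRxMexpNx_1 _ x) mulrC ler_pM2l//.
  exact: (expR_ge1Dx (- x)).
nra.
Qed.

(** Since (1 - x) (1 + x + x^2) = 1 - x^3 >= 1 >= (1 - x) e^x for x <= 0, the positive factor 1 - x
    cancels. *)
Lemma expR_le_neg (R : realType) (x : R) : x <= 0 ->
  expR x <= 1 + x + x ^+ 2.
Proof.
move=> x0; have e0 := expR_gt0 x.
have : (1 - x) * expR x <= 1.
  rewrite -[leRHS](@expRxMexpNx_1 _ x) mulrC ler_pM2l//.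
  exact: (expR_ge1Dx (- x)).
move=> h; have : 1 <= (1 - x) * (1 + x + x ^+ 2) by nra.
move=> h'; have : (1 - x) * expR x <= (1 - x) * (1 + x + x ^+ 2) by lra.
by rewrite ler_pM2l//; lra.
Qed.

Lemma expR_le_moments (R : realType) (s t x : R) : 0 < s -> 0 < t -> t <= s / 2 ->
  expR (t * x) <= 1 + t * x + t ^+ 2 * (x ^+ 2 + 8 / s ^+ 2 * expR (s * x)).
Proof.
move=> s0 t0 ts.
(* for x >= 0, half of the exponent s x is spent on absorbing the factor x ^+ 2 *)
have [x0|x0] := leP 0 x; last first.
  apply: le_trans (expR_le_neg _) _; first by nra.
  rewrite lerD2l exprMn ler_wpM2l ?sqr_ge0// lerDl.
  by rewrite mulr_ge0 ?expR_ge0// divr_ge0// sqr_ge0.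
apply: le_trans (expR_le_pos _) _; first by nra.
rewrite lerD2l exprMn -[leLHS]mulrA ler_wpM2l ?sqr_ge0//.
apply: (@le_trans _ _ (8 / s ^+ 2 * expR (s * x))); last first.
  by rewrite lerDr sqr_ge0.
have h : s / 2 * x + s / 2 * x = s * x by field.
rewrite -h expRD mulrA.
apply: ler_pM; rewrite ?sqr_ge0 ?expR_ge0//; last first.
  by rewrite ler_expR ler_wpM2r.
have sx0 : 0 <= s / 2 * x by nra.
(* Source of the constant 8: e^y >= 1 + y^2 / 2 at y = s x / 2 gives x^2 <= 8 s^-2 e^(s x / 2). *)
have := expR_ge1Dxn 1 sx0.
have -> : (s / 2 * x) ^+ 2 / 2`!%:R = s ^+ 2 * x ^+ 2 / 8 :> R.
  by rewrite (_ : 2`!%:R = 2 :> R)//; field.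
rewrite [8 / _ * _]mulrAC ler_pdivlMr ?exprn_gt0// => h'; lra.
Qed.

(** * ESI with a constant slack: Jensen, Chernoff, moment criterion *)

Section esi_lemmas.
Context d (T : measurableType d) (R : realType) (P : probability T R).
Implicit Types (X Y : T -> R) (a b eta K M : R).

Lemma ge0_expectation_le X Y :
    measurable_fun setT X -> measurable_fun setT Y ->
    (forall w, 0 <= X w) -> (forall w, X w <= Y w) ->
  ('E_P[X] <= 'E_P[Y])%E.
Proof.
move=> mX mY X0 XY; apply: expectation_le => //.
- by move=> w; exact: le_trans (X0 w) (XY w).
- by apply/aeW.
Qed.

Lemma ge0_Lfun1 X K : measurable_fun setT X -> (forall w, 0 <= X w) ->
  ('E_P[X] <= K%:E)%E -> X \in Lfun P 1.
Proof.
move=> mX X0; rewrite unlock => XK; apply/Lfun1_integrable/integrableP; split.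
  exact/measurable_EFinP.
rewrite (@le_lt_trans _ _ K%:E) ?ltry//.
under eq_integral => w _ do rewrite gee0_abs ?lee_fin//.
exact: XK.
Qed.

Lemma Lfun1_measurable X : X \in Lfun P 1 -> measurable_fun setT X.
Proof. by move=> /Lfun1_integrable/measurable_int/measurable_EFinP. Qed.

Lemma measurable_expRM eta X : measurable_fun setT X ->
  measurable_fun setT (fun w => expR (eta * X w)).
Proof.
by move=> mX; apply: measurableT_comp => //; exact: measurable_funM.
Qed.

Lemma esi_cstE eta X a : measurable_fun setT X ->
  esi P eta X (cst a) <->
  ('E_P[fun w => expR (eta * X w)] <= (expR (eta * a))%:E)%E.
Proof.
move=> mX; rewrite /esi.
have -> : (fun w => expR (eta * (X w - cst a w))) =
    (fun w => expR (- (eta * a)) * expR (eta * X w)).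
  by apply/funext => w; rewrite -expRD /=; congr expR; ring.
rewrite unlock.
under eq_integral => w _ do rewrite EFinM.
rewrite ge0_integralZl_EFin ?expR_ge0//; last first.
  by apply/measurable_EFinP; exact: measurable_expRM.
by rewrite expRN lee_pdivrMl ?expR_gt0// mule1.
Qed.

Lemma esi_fun_cst0E (u : R -> R) X : measurable_fun setT X ->
  esi_fun P u X (cst 0) <-> forall eps, 0 < eps -> esi P (u eps) X (cst eps).
Proof.
move=> mX; split=> h eps eps0; move/(_ _ eps0): h;
  rewrite esi_cstE//; congr (_ <= _)%E; congr expectation;
  by apply/funext => w; rewrite subr0.
Qed.

Lemma esi_le eta X Y a b : measurable_fun setT X -> measurable_fun setT Y ->
    0 <= eta -> (forall w, X w - a <= Y w - b) ->
  esi P eta Y (cst b) -> esi P eta X (cst a).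
Proof.
move=> mX mY eta0 XY; apply: le_trans; apply: ge0_expectation_le.
- by apply: measurable_expRM; exact: measurable_funB.
- by apply: measurable_expRM; exact: measurable_funB.
- by move=> w; exact: expR_ge0.
- by move=> w; rewrite ler_expR ler_wpM2l.
Qed.

(** Jensen's inequality through the tangent at 0: integrate 1 + eta (X - a) <= e^(eta (X - a)). *)
Lemma esi_expectation_le eta X a : X \in Lfun P 1 -> 0 < eta ->
  esi P eta X (cst a) -> ('E_P[X] <= a%:E)%E.
Proof.
move=> iX eta0 Xa; have mX := Lfun1_measurable iX.
have iexp : (fun w => expR (eta * (X w - cst a w))) \in Lfun P 1.
  apply: (ge0_Lfun1 _ _ Xa); first by apply: measurable_expRM; exact: measurable_funB.
  by move=> w; exact: expR_ge0.
have iaff : eta \o* (X \- cst a) \in Lfun P 1.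
  by apply: Lfun_scale => //; apply: rpredB => //; exact: Lfun_cst.
have : ('E_P[(cst 1 \+ eta \o* (X \- cst a))%R] <= 1)%E.
  apply: le_trans Xa; rewrite unlock; apply: le_integral => //.
  - by apply/Lfun1_integrable; apply: rpredD => //; exact: Lfun_cst.
  - exact/Lfun1_integrable.
  - by move=> w _; rewrite lee_fin /= mulrC; exact: expR_ge1Dx.
rewrite expectationD ?Lfun_cst// expectation_cst expectationZl ?expectationB//;
  rewrite ?Lfun_cst//; last by apply: rpredB => //; exact: Lfun_cst.
rewrite expectation_cst; have := expectation_fin_num iX.
case: 'E_P[X]%E => // m _; rewrite -EFinB -EFinM -EFinD !lee_fin => h.
by rewrite -subr_le0 -(pmulr_rle0 _ eta0); lra.
Qed.

Lemma esi_tail eta (X : {RV P >-> R}) a t : 0 < eta -> esi P eta X (cst a) ->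
  (P [set w | (t <= X w)%R] <= (expR (eta * (a - t)))%:E)%E.
Proof.
move=> eta0 /esi_cstE Xa; apply: le_trans (chernoff X t eta0) _.
rewrite mulrBr expRD EFinM lee_wpmul2r ?lee_fin ?expR_ge0// /mmt_gen_fun.
apply: le_trans (Xa _) => //; rewrite [X in ('E_P[X] <= _)%E](_ : _ =
  (fun w => expR (eta * X w)))//.
by apply/funext => w /=; rewrite mulrC.
Qed.

(** Integrating [expR_le_moments], the linear term is nonpositive because E[X] <= 0, and 1 + y <=
    e^y turns the quadratic remainder into an exponential. *)
Lemma esi_of_moments eta etas X M K :
    X \in Lfun P 1 -> ('E_P[X] <= 0)%E ->
    ('E_P[fun w => (X w ^+ 2)%R] <= M%:E)%E ->
    ('E_P[fun w => expR (etas * X w)] <= K%:E)%E ->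
    0 < etas -> 0 < eta -> eta <= etas / 2 ->
  esi P eta X (cst (eta * (M + 8 / etas ^+ 2 * K))).
Proof.
move=> iX X0 XM XK etas0 eta0 eta_le; have mX := Lfun1_measurable iX.
set q := 8 / etas ^+ 2.
pose S w := X w ^+ 2; pose W w := expR (etas * X w).
have iS : S \in Lfun P 1.
  by apply: (ge0_Lfun1 _ _ XM); [exact: measurable_funX|move=> w; exact: sqr_ge0].
have iW : W \in Lfun P 1.
  apply: (ge0_Lfun1 _ _ XK) => [|w]; [exact: measurable_expRM|exact: expR_ge0].
pose B : T -> R := (cst 1 \+ eta \o* X) \+ (eta ^+ 2) \o* (S \+ q \o* W).
have iqW : q \o* W \in Lfun P 1 by exact: Lfun_scale.
have iSW : S \+ q \o* W \in Lfun P 1 by exact: rpredD.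
have icX : cst 1 \+ eta \o* X \in Lfun P 1.
  by apply: rpredD; [exact: Lfun_cst|exact: Lfun_scale].
have iB : B \in Lfun P 1 by apply: rpredD => //; exact: Lfun_scale.
apply/esi_cstE => //; apply: (@le_trans _ _ 'E_P[B]%E).
  apply: ge0_expectation_le.
  - exact: measurable_expRM.
  - exact: Lfun1_measurable.
  - by move=> w; exact: expR_ge0.
  - move=> w; apply: le_trans (expR_le_moments _ etas0 eta0 eta_le) _.
    by rewrite /B /= /S /W /q; lra.
rewrite /B expectationD ?Lfun_scale// expectationD ?Lfun_scale ?Lfun_cst//.
rewrite expectation_cst !expectationZl// expectationD// expectationZl//.
move: XM XK X0; rewrite -/S -/W.
have := expectation_fin_num iX; have := expectation_fin_num iS.
have := expectation_fin_num iW.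
case: 'E_P[W]%E => // k _; case: 'E_P[S]%E => // s _; case: 'E_P[X]%E => // m _.
rewrite -?EFinM -?EFinD -?EFinM -?EFinD !lee_fin => sM kK m0.
apply: le_trans (expR_ge1Dx _); rewrite -addrA lerD2l.
have q0 : 0 <= q by rewrite divr_ge0// sqr_ge0.
have : q * k <= q * K by rewrite ler_wpM2l.
have : eta * m <= 0 by rewrite pmulr_rle0.
have e20 : 0 <= eta ^+ 2 by exact: sqr_ge0.
move=> h1 h2; have : eta ^+ 2 * (s + q * k) <= eta ^+ 2 * (M + q * K).
  by rewrite ler_wpM2l// lerD.
lra.
Qed.

End esi_lemmas.

(** * Exponential moments from exponential tails *)

Section tails.
Context d (T : measurableType d) (R : realType) (P : probability T R).

Lemma measurable_rv_ge (X : {RV P >-> R}) (t : R) :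
  measurable [set w | t <= X w].
Proof.
rewrite [X in measurable X](_ : _ = X @^-1` `[t, +oo[%classic).
  by rewrite -[X in measurable X]setTI; exact: measurable_funPT.
by apply/seteqP; split=> w /=; rewrite in_itv/= andbT.
Qed.

(* Slices the space by the level sets n <= X, so that on the n-th slice
   exp (b X / 2) <= exp (b (n + 1) / 2). *)
Lemma expectation_expR_of_tail (X : {RV P >-> R}) (a b : R) : 0 <= a -> 0 < b ->
  (forall t, 1 <= t -> (P [set w | (t <= X w)%R] <= (a * expR (- (t * b)))%:E)%E) ->
  ('E_P[fun w => expR (b / 2 * X w)]
     <= ((1 + a) * expR (b / 2) * (1 - expR (- (b / 2)))^-1)%:E)%E.
Proof.
move=> a0 b0 tail; set s := b / 2; have s0 : 0 < s by rewrite divr_gt0.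
(* Slice 0 is the whole space because [Num.truncn] sends negative values of [X] to 0. Its mass 1 is
   why the prefactor is 1 + a instead of a. *)
pose B n : set T := if n is 0%N then setT else [set w | n%:R <= X w].
have mB n : measurable (B n) by case: n => //= n; exact: measurable_rv_ge.
pose f n w : \bar R := (expR (s * n.+1%:R) * \1_(B n) w)%:E.
have f0 n w : (0 <= f n w)%E by rewrite lee_fin mulr_ge0 ?expR_ge0.
have mf n : measurable_fun setT (f n).
  by apply/measurable_EFinP/measurable_funM => //; exact: measurable_indic.
have PB n : (P (B n) <= ((1 + a) * expR (- (n%:R * b)))%:E)%E.
  case: n => [|n]; first by rewrite probability_setT mul0r oppr0 expR0 mulr1 lee_fin lerDl.
  apply: le_trans (tail n.+1%:R _) _; first by rewrite ler1n.
  by rewrite lee_fin ler_wpM2r ?expR_ge0// lerDr.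
rewrite unlock; apply: (@le_trans _ _ (\int[P]_w \sum_(n <oo) f n w)%E).
  apply: ge0_le_integral => //.
  - by apply/measurable_EFinP; exact: measurable_expRM.
  - by apply: (ge0_emeasurable_sum (P := xpredT)).
  - move=> w _; set n := Num.truncn (X w).
    apply: le_trans (nneseries_lim_ge n.+1 _) => //.
    rewrite big_nat_recr//=; apply: le_trans (leeDr _ _); last exact: sume_ge0.
    rewrite /f lee_fin indicE mem_set; last first.
      rewrite /B; case En: n => [|m]//=; rewrite -En /n truncn_le.
      by rewrite (le_trans ler01)// -truncn_gt0 -/n En.
    by rewrite mulr1 ler_expR ler_wpM2l ?ltW// truncnS_gt.
rewrite integral_nneseries//.
set q := expR (- s).
(* As b = 2 s, e^(s (n + 1)) e^(- n b) = e^s q^n: halving the exponent leaves a convergent geometric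
   series. *)
apply: (@le_trans _ _ (\sum_(n <oo) (geometric ((1 + a) * expR s) q n)%:E)%E).
  apply: lee_nneseries => [n _ _|n _]; first exact: integral_ge0.
  rewrite /f; under eq_integral => w _ do rewrite EFinM.
  rewrite ge0_integralZl_EFin ?expR_ge0//; last first.
    by apply/measurable_EFinP; exact: measurable_indic.
  rewrite integral_indic// setIT -lee_pdivlMl ?expR_gt0//.
  apply: le_trans (PB n) _; rewrite /= lee_fin /q -expRM_natr -expRN.
  rewrite [leRHS]mulrCA -[leRHS]mulrA ler_wpM2l ?addr_ge0//.
  rewrite -!expRD ler_expR -natr1 /s.
  by rewrite le_eqVlt; apply/orP; left; apply/eqP; field.
apply: lime_le; first by apply: is_cvg_nneseries => n _ _;
  rewrite lee_fin mulr_ge0 ?exprn_ge0 ?expR_ge0 ?mulr_ge0 ?addr_ge0 ?expR_ge0.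
apply: nearW => n; rewrite sumEFin lee_fin.
apply: geometric_le_lim; rewrite ?expR_gt0 ?mulr_ge0 ?addr_ge0 ?expR_ge0//.
by rewrite ger0_norm ?expR_ge0// expR_lt1 oppr_lt0.
Qed.

End tails.

(** * Admissible ESI functions and tail rates *)

Lemma ESI_function_min (R : realType) (C e : R) : 0 < C -> 0 < e ->
  ESI_function (fun eps => Num.min (C * eps) e).
Proof.
move=> C0 e0; split.
- apply: continuous_subspaceT => x.
  apply: (@continuous_min R R ( *%R C) (cst e)); last exact: cvg_cst.
  exact: mulrl_continuous.
- by move=> x y _ xy; rewrite le_min !ge_min ler_pM2l// xy lexx !orbT.
- by move=> eps eps0; rewrite lt_min mulr_gt0.
Qed.

Lemma tail_rate_cst (R : realType) (b : R) : 0 < b -> tail_rate (cst b).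
Proof.
move=> b0; split.
- split=> [eps _|]; first exact: derivable_cst.
  rewrite (_ : (fun t => _) = cst 0); first exact: is_cvg_cst.
  by apply/funext => t; rewrite subrr mul0r.
- by move=> *; exact: ltW.
- by [].
- by move=> eps _; rewrite derive1_cst.
Qed.

Lemma tail_rate_le (R : realType) (h : R -> R) (x y : R) :
  tail_rate h -> 0 < x -> x <= y -> h x <= h y.
Proof.
move=> [[dh _] _ _ h'0] x0 xy.
apply: (@ger0_derive1_ndecry _ h x) => //.
- by move=> z; rewrite in_itv/= andbT => xz; apply: dh; exact: lt_trans xz.
- by move=> z; rewrite in_itv/= andbT => xz; apply: h'0; exact: lt_trans xz.
- apply: derivable_within_continuous => z; rewrite in_itv/= andbT => xz.
  by apply: dh; exact: lt_le_trans xz.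
Qed.

(** * Integrability and centering under a second-moment bound *)

Section second_moment.
Context d (T : measurableType d) (R : realType) (P : probability T R).
Variables (X : {RV P >-> R}) (M : R).
Hypothesis XM : ('E_P[fun w => (X w ^+ 2)%R] <= M%:E)%E.

Let iS : (fun w => X w ^+ 2) \in Lfun P 1.
Proof.
apply: (ge0_Lfun1 _ _ XM); first exact: measurable_funX.
by move=> w; exact: sqr_ge0.
Qed.

Let le1S w : `|X w| <= 1 + X w ^+ 2.
Proof.
rewrite -(@real_normK _ (X w)) ?num_real//.
have := sqr_ge0 (`|X w| - 2^-1); lra.
Qed.

Let E1S : ('E_P[(cst 1 \+ (fun w => X w ^+ 2))%R] <= (1 + M)%:E)%E.
Proof.
by rewrite expectationD ?Lfun_cst// expectation_cst EFinD leeD2l.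
Qed.

Let EnormX : ('E_P[fun w => `|X w|%R] <= (1 + M)%:E)%E.
Proof.
apply: le_trans E1S; apply: ge0_expectation_le => //.
- exact: measurableT_comp.
- by apply: measurable_funD => //; exact: measurable_funX.
Qed.

Lemma Lfun1_of_sqr : (X : T -> R) \in Lfun P 1.
Proof.
have /Lfun1_integrable iN : (fun w => `|X w|) \in Lfun P 1.
  by apply: (ge0_Lfun1 _ _ EnormX) => //; exact: measurableT_comp.
apply/Lfun1_integrable; apply: le_integrable iN => //.
  exact/measurable_EFinP.
by move=> w _; rewrite /= normr_id.
Qed.

(** Guarantees that [fine] in [centered] does not fall back to its default value. *)
Lemma expectation_fineK : (fine 'E_P[X])%:E = 'E_P[X]%E.
Proof. by rewrite fineK// expectation_fin_num// Lfun1_of_sqr. Qed.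

Lemma normr_expectation_le : `|fine 'E_P[X]| <= 1 + M.
Proof.
rewrite -lee_fin -abse_EFin expectation_fineK.
apply: le_trans EnormX; rewrite unlock.
apply: le_trans (le_abse_integral _ _ _) _ => //.
exact/measurable_EFinP.
Qed.

Lemma measurable_centered : measurable_fun setT (centered P X).
Proof. exact: measurable_funB. Qed.

Lemma Lfun1_centered : centered P X \in Lfun P 1.
Proof.
rewrite (_ : centered P X = (X : T -> R) \- cst (fine 'E_P[X]))//.
by apply: rpredB; [exact: Lfun1_of_sqr|exact: Lfun_cst].
Qed.

Lemma expectation_centered : 'E_P[centered P X]%E = 0%E.
Proof.
rewrite (_ : centered P X = (X : T -> R) \- cst (fine 'E_P[X]))//.
rewrite expectationB ?Lfun1_of_sqr ?Lfun_cst// expectation_cst.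
by rewrite expectation_fineK subee// expectation_fin_num// Lfun1_of_sqr.
Qed.

(** Uses (X - m)^2 <= 2 X^2 + 2 m^2, which is (X + m)^2 >= 0, together with |m| <= 1 + M. *)
Lemma expectation_centered_sqr_le :
  ('E_P[fun w => (centered P X w ^+ 2)%R] <= (2 * M + 2 * (1 + M) ^+ 2)%:E)%E.
Proof.
set m := fine 'E_P[X].
apply: (@le_trans _ _
  'E_P[((2 \o* (fun w => X w ^+ 2)) \+ cst (2 * (1 + M) ^+ 2))%R]%E).
  apply: ge0_expectation_le.
  - by apply: measurable_funX; exact: measurable_centered.
  - by apply: measurable_funD => //; apply: measurable_funM => //; exact: measurable_funX.
  - by move=> w; exact: sqr_ge0.
  - move=> w /=; rewrite /centered -/m.
    have : m ^+ 2 <= (1 + M) ^+ 2.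
      rewrite -(@real_normK _ m) ?num_real// lerXn2r ?nnegrE//;
        last exact: normr_expectation_le.
      exact: le_trans normr_expectation_le.
    have := sqr_ge0 (X w + m); lra.
rewrite expectationD ?Lfun_cst ?Lfun_scale// expectation_cst expectationZl//.
by rewrite [leRHS]EFinD leeD2r// [leRHS]EFinM lee_wpmul2l.
Qed.

Lemma subcentered_centered : subcentered P X <-> forall w, X w <= centered P X w.
Proof.
rewrite /subcentered -expectation_fineK lee_fin; split=> [m0 w|h].
  by rewrite /centered lerBrDr gerDl.
rewrite leNgt; apply/negP => m0.
(* With a positive mean the pointwise inequality fails at every point, so it could only hold on an
   empty space, which cannot carry mass 1. *)
have T0 : [set: T] = set0.
  apply/seteqP; split=> // w _; have := h w.
  by rewrite /centered lerBrDr gerDl leNgt m0.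
by have := @probability_setT _ _ _ P; rewrite T0 measure0 => /eqP; rewrite eqe eq_sym oner_eq0.
Qed.

End second_moment.

(** * Uniform moment bound and the cycle of implications *)

Lemma regular_family_bound d (T : measurableType d) (R : realType)
    (P : probability T R) (F : Type) (X : F -> {RV P >-> R}) :
  regular_family X -> exists M : R, 0 < M /\
    forall f, ('E_P[fun w => (X f w ^+ 2)%R] <= M%:E)%E.
Proof.
rewrite /regular_family => supX.
have X0 f : ('E_P[fun w => (X f w ^+ 2)%R] <= ereal_sup
    [set 'E_P[(fun w => X f w ^+ 2)%R] | f in [set: F]])%E.
  by apply: ereal_sup_ubound; exists f.
(* The supremum is -oo when the family is empty; any positive bound then serves. *)
case: ereal_sup supX X0 => // [r _|_] X0; last first.
  by exists 1; split=> // f; apply: le_trans (X0 f) _; exact: leNye.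
exists (1 + `|r|); split; first by rewrite ltr_pwDl.
move=> f; apply: le_trans (X0 f) _; rewrite lee_fin.
by rewrite (le_trans (ler_norm r))// lerDr.
Qed.

(* In the last item the exponent is eps * h eps: h is the rate, so a constant h
   gives an exponential tail and a linear h a Gaussian one. With exponent h eps
   a constant h would make the bound vacuous (take a large). *)
Theorem proposition15 (d : measure_display) (T : measurableType d)
    (R : realType) (P : probability T R) (F : Type) (X : F -> {RV P >-> R})
    (regX : regular_family X) :
  [<->
    exists u : R -> R, ESI_function u /\
      forall f : F, esi_fun P u (X f) (cst 0);
    exists Cs etas : R, [/\ 0 < Cs, 0 < etas &
      forall f : F, (forall w, X f w <= centered P (X f) w) /\
        esi P etas (centered P (X f)) (cst Cs)];
    exists c v : R, [/\ 0 < c, 0 < v &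
      forall f : F, subcentered P (X f) /\ subgamma_right_tail P c v (X f)];
    exists C etas : R, let h := fun eps => Num.min (C * eps) etas in
      ESI_function h /\
      forall f : F, (forall w, X f w <= centered P (X f) w) /\
        esi_fun P h (centered P (X f)) (cst 0);
    exists c v : R, [/\ 0 < c, 0 < v &
      forall f : F, subcentered P (X f) /\
        forall delta : R, 0 < delta -> delta <= 1 ->
          ((1 - delta)%:E <=
            P [set w | (X f w <= Num.sqrt (2 * v * ln (1 / delta))
                                 + c * ln (1 / delta))%R])%E];
    exists (a : R) (h : R -> R), [/\ 0 < a, tail_rate h &
      forall f : F, subcentered P (X f) /\
        forall eps : R, 0 < eps ->
          (P [set w | (eps <= X f w)%R] <= (a * expR (- (eps * h eps)))%:E)%E]
  ].
Proof.
have [M [M0 XM]] := regular_family_bound regX.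
have iX f : (X f : T -> R) \in Lfun P 1 := Lfun1_of_sqr (XM f).
have mX f : measurable_fun setT (X f) by [].
have mZ f : measurable_fun setT (centered P (X f)) by exact: measurable_centered.
have Eabs f : `|fine 'E_P[X f]| <= 1 + M := normr_expectation_le (XM f).
tfae.
- move=> [u [[_ u_nd u_gt0] Xu]].
  (* The slack 2 + M is 1 from the ESI at eps = 1 plus the bound 1 + M on |E[X f]|. *)
  exists (2 + M), (u 1); split; [by lra|exact: u_gt0|move=> f].
  have {}Xu eps : 0 < eps -> esi P (u eps) (X f) (cst eps).
    exact: (esi_fun_cst0E P u (mX f)).1 (Xu f) eps.
  split.
    apply/(subcentered_centered (XM f))/lee_addgt0Pr => eps eps0.
    by rewrite add0e; apply: esi_expectation_le (u_gt0 _ eps0) (Xu _ eps0).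
  apply: esi_le (Xu _ ltr01) => //; first by rewrite ltW// u_gt0.
  move=> w; rewrite /centered; have := Eabs f; rewrite ler_norml; lra.
- move=> [C [s [C0 s0 XC]]].
  set V := 2 * M + 2 * (1 + M) ^+ 2 + 8 / s ^+ 2 * expR (s * C).
  have V0 : 0 < V.
    rewrite /V ltr_pwDl ?mulr_ge0 ?expR_ge0 ?invr_ge0 ?sqr_ge0//.
    by rewrite ltr_pwDl ?mulr_gt0// mulr_ge0 ?sqr_ge0.
  (* With c = 2 / s, c eta < 1 says eta < s / 2, the range of the moment criterion. With v = 2 V the
     subgamma slack is eta V / (1 - c eta) >= eta V. *)
  exists (2 / s), (2 * V); split; [by rewrite divr_gt0|by rewrite mulr_gt0|].
  move=> f; have [Xc Zs] := XC f; split.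
    exact/(subcentered_centered (XM f)).
  move=> eta eta0 eta_lt; have d0 : 0 < 1 - 2 / s * eta by lra.
  have eta_s : eta <= s / 2.
    by move: eta_lt; rewrite mulrAC ltr_pdivrMr// mul1r; lra.
  have := @esi_of_moments _ _ _ P eta s _ _ _ (Lfun1_centered (XM f)) _
    (expectation_centered_sqr_le (XM f)) ((esi_cstE P s C (mZ f)).1 Zs) s0 eta0 eta_s.
  rewrite (expectation_centered (XM f)) => /(_ (lexx _)).
  apply: esi_le => // [|w]; first exact: ltW.
  rewrite lerD2l lerN2 -/V.
  have -> : 2^-1 * (2 * V * eta / (1 - 2 / s * eta)) =
      eta * V / (1 - 2 / s * eta) by rewrite mulrA; congr (_ / _); field.
  rewrite ler_pdivlMr// ler_piMr ?mulr_ge0 ?(ltW V0) ?(ltW eta0)//.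
  by rewrite gerBl mulr_ge0 ?divr_ge0// ltW.
- move=> [c [v [c0 v0 Xcv]]].
  (* The cap keeps 1 - c h >= 1/2, so the subgamma slack is at most v h, and the linear branch makes
     v h <= eps. *)
  exists v^-1, (2 * c)^-1 => h.
  have Eh : ESI_function h by apply: ESI_function_min; rewrite invr_gt0 ?mulr_gt0.
  split=> // f; have [Xs Xt] := Xcv f; split.
    exact/(subcentered_centered (XM f)).
  apply/(esi_fun_cst0E _ _ (mZ f)) => eps eps0; have [_ _ h0] := Eh.
  have heps : h eps <= v^-1 * eps by rewrite /h ge_min lexx.
  have hc : c * h eps <= 2^-1.
    have : h eps <= (2 * c)^-1 by rewrite /h ge_min lexx orbT.
    by rewrite invfM -(ler_pM2l c0) mulrCA divff ?mulr1 ?gt_eqF.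
  have := Xt _ (h0 _ eps0); move=> /(_ ltac:(lra)).
  apply: esi_le => // [|w]; first by rewrite ltW ?h0.
  rewrite lerD2l lerN2 mulrA ler_pdivrMr; last by lra.
  move: heps; rewrite mulrC ler_pdivlMr// => heps.
  nra.
- move=> [C [s [[_ _ h_gt0] Xh]]].
  set h := fun eps => Num.min (C * eps) s in h_gt0 Xh.
  have [C0 s0] : 0 < C /\ 0 < s.
    by have := h_gt0 _ ltr01; rewrite /h lt_min mulr1 => /andP[].
  (* One constant per branch of the min: v = 2 / C gives C (r / 2)^2 = L for r = sqrt(2 v L), and c
     = 1 / s gives s c L = L. *)
  exists s^-1, (2 / C); split; [by rewrite invr_gt0|by rewrite divr_gt0|].
  move=> f; have [Xc /(esi_fun_cst0E _ _ (mZ f)) Zh] := Xh f; split.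
    exact/(subcentered_centered (XM f)).
  move=> delta delta0; rewrite le_eqVlt => /predU1P[->|delta1].
    by rewrite subrr.
  rewrite div1r lnV ?posrE//; set L := - ln delta.
  have L0 : 0 < L by rewrite oppr_gt0 ln_lt0// delta0.
  set r := Num.sqrt _; set t := r + _.
  have r0 : 0 < r by rewrite sqrtr_gt0 !mulr_gt0 ?invr_gt0.
  have Lr : C * r ^+ 2 = 4 * L.
    by rewrite sqr_sqrtr ?ltW ?mulr_gt0 ?invr_gt0//; field; rewrite gt_eqF.
  (* the ESI at e = r / 2 suffices: h e * (t - e) >= L in both branches of the min *)
  set e := r / 2; have e0 : 0 < e by rewrite divr_gt0.
  have Xe : esi P (h e) (X f) (cst e).
    by apply: esi_le (Zh _ e0) => // [|w]; rewrite ?lerD2r; [exact/ltW/h_gt0|exact: Xc].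
  have rate : h e * (e - t) <= - L.
    have Ls : s * (s^-1 * L) = L by rewrite mulrA divff ?mul1r ?gt_eqF.
    have sL0 : 0 <= s^-1 * L by rewrite ltW ?mulr_gt0 ?invr_gt0.
    rewrite /h /t; have [_|_] := leP (C * e) s; rewrite /e; last by nra.
    have := mulr_ge0 (ltW (mulr_gt0 C0 r0)) sL0; lra.
  rewrite (_ : [set w | _] = ~` (X f @^-1` `]t, +oo[%classic)); last first.
    apply/seteqP; split=> w /=; rewrite in_itv/= andbT.
      by rewrite ltNge => ->.
    by move=> /negP; rewrite -leNgt.
  have mt : measurable (X f @^-1` `]t, +oo[%classic).
    by rewrite -[X in measurable X]setTI; exact: measurable_funPT.
  rewrite probability_setC// EFinB leeB//.
  apply: (@le_trans _ _ (P [set w | (t <= X f w)%R])).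
    apply: le_measure; rewrite ?inE//; first exact: measurable_rv_ge.
    by move=> w /=; rewrite in_itv/= andbT => /ltW.
  apply: le_trans (esi_tail _ (h_gt0 _ e0) Xe) _.
  by rewrite lee_fin -(lnK (x := delta)) ?posrE// ler_expR -[ln _]opprK.
- move=> [c [v [c0 v0 Xcv]]].
  set b := (c + 1)^-1; have b0 : 0 < b by rewrite invr_gt0 addr_gt0.
  (* sqrt (2 v L) <= v + L turns the quantile bound into an exponential tail;
     the prefactor makes it trivial for eps <= v + 1 *)
  exists (expR ((v + 1) * b)), (cst b); split.
  + exact: expR_gt0.
  + exact: tail_rate_cst.
  move=> f; have [Xs Xt] := Xcv f; split=> // eps eps0.
  rewrite -expRD (_ : _ + _ = - ((eps - v - 1) * b)); last by rewrite /cst; ring.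
  set L := (eps - v - 1) * b.
  have [L0|L0] := leP L 0.
    apply: le_trans (probability_le1 _ (measurable_rv_ge _ _)) _.
    by rewrite lee_fin -expR0 ler_expR oppr_ge0.
  have Lb : (c + 1) * L = eps - v - 1.
    by rewrite /L mulrCA divff ?mulr1// gt_eqF// addr_gt0.
  have := Xt (expR (- L)) (expR_gt0 _).
  rewrite -ler_ln ?posrE ?expR_gt0// expRK ln1 oppr_le0 (ltW L0) => /(_ isT).
  rewrite div1r -expRN opprK expRK; set A := [set w | _] => PA.
  (* The left side is at most v + (c + 1) L = eps - 1. The 1 subtracted in [L] makes this strict, so
     eps <= X f is disjoint from [A]. *)
  have At : Num.sqrt (2 * v * L) + c * L < eps.
    have r0 := sqrtr_ge0 (2 * v * L).
    have : Num.sqrt (2 * v * L) ^+ 2 = 2 * v * L.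
      by rewrite sqr_sqrtr; have := mulr_gt0 v0 L0; lra.
    move=> r2; have : Num.sqrt (2 * v * L) <= v + L.
      rewrite -ler_sqr ?nnegrE; [|lra|lra].
      rewrite r2; have := sqr_ge0 v; have := sqr_ge0 L; lra.
    lra.
  have mA : measurable A.
    rewrite (_ : A = X f @^-1` `]-oo, Num.sqrt (2 * v * L) + c * L]%classic).
      by rewrite -[X in measurable X]setTI; exact: measurable_funPT.
    by apply/seteqP; split=> w /=; rewrite in_itv.
  apply: (@le_trans _ _ (P (~` A))).
    apply: le_measure; rewrite ?inE//; [exact: measurable_rv_ge|exact: measurableC|].
    by move=> w /= epsX XA; have := lt_le_trans At (le_trans epsX XA); rewrite ltxx.
  rewrite probability_setC//; move: PA; rewrite -[P A]fineK ?fin_num_measure//.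
  by rewrite -EFinB !lee_fin; lra.
- move=> [a [h [a0 h_rate Xh]]].
  have [_ _ h_gt0 _] := h_rate.
  set b := h 1; have b0 : 0 < b by exact: h_gt0.
  have expX f := @expectation_expR_of_tail _ _ _ P (X f) a b (ltW a0) b0.
  move: expX; set K := (1 + a) * _ * _ => expX.
  set s := b / 2; have s0 : 0 < s by rewrite divr_gt0.
  set V := M + 8 / s ^+ 2 * K.
  have V0 : 0 < V.
    have K0 : 0 <= K.
      apply: mulr_ge0; first by rewrite mulr_ge0 ?expR_ge0// addr_ge0// ltW.
      by rewrite invr_ge0 subr_ge0 expR_le1 oppr_le0 ltW.
    by rewrite ltr_pwDl// mulr_ge0// divr_ge0 ?sqr_ge0 ?ler0n.
  (* The cap s / 2 keeps the rate within the moment criterion; the linear branch makes its slack u V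
     at most eps. *)
  set u := fun eps => Num.min (V^-1 * eps) (s / 2).
  have Eu : ESI_function u by apply: ESI_function_min; rewrite ?invr_gt0 ?divr_gt0.
  have [_ _ u_gt0] := Eu.
  exists u; split=> // f; have [Xs Xt] := Xh f.
  apply/(esi_fun_cst0E _ _ (mX f)) => eps eps0.
  have Ks : ('E_P[fun w => expR (s * X f w)] <= K%:E)%E.
    apply: expX => t t1; apply: le_trans (Xt _ (lt_le_trans ltr01 t1)) _.
    rewrite lee_fin ler_pM2l// ler_expR lerN2 ler_pM2l ?(lt_le_trans ltr01)//.
    exact: tail_rate_le.
  have us : u eps <= s / 2 by rewrite /u ge_min lexx orbT.
  apply: esi_le (esi_of_moments (iX f) Xs (XM f) Ks s0 (u_gt0 _ eps0) us) => //.
    exact/ltW/u_gt0.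
  move=> w; rewrite lerD2l lerN2 -/V -ler_pdivlMr// mulrC.
  by rewrite /u ge_min lexx.
Qed.
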